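(* Let $B$ be a commutative ring, let $A$ be a ring that is a free right $B$-module of rank $m$, and assume there is an ordered basis $e=(e_1,\dots,e_m)$ of $A$ as a right $B$-module such that (i) $e_i$ is invertible in $A$ for every $i$; (ii) $e_i^{-1}Be_i\subset B$ for every $i$. Let $L:A\to \mathrm{M}(m,B)$ be a left regular representation, let $a\in A$, and let $\Phi_{L(a)}(x)=\det(xI_m-L(a))=x^m+b_{m-1}x^{m-1}+\cdots+b_0\in B[x]$ be the characteristic polynomial of $L(a)$. Then $$\Phi_{L(a)}(a)=a^m+b_{m-1}a^{m-1}+\cdots+b_0=0\quad\text{in } A.$$
   Context: Rings have a multiplicative unit; $\mathrm{M}(m,B)$ is the ring of $m\times m$ matrices over $B$. ''$A$ is a free right $B$-module of rank $m$'' means that $B$ is a subring of $A$ and $A=\bigoplus_{i=1}^m e_iB$ for some ordered basis. The left regular representation $L_e:A\to \mathrm{M}(m,B)$ with respect to an ordered basis $e$ is the injective ring homomorphism $a\mapsto(b_{ij})$ defined by $ae_j=\sum_ie_ib_{ij}$. *)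

(* Defs.v *)
From mathcomp Require Import all_boot all_order all_algebra.

Set Implicit Arguments.
Unset Strict Implicit.
Unset Printing Implicit Defensive.

Import GRing.Theory.
Local Open Scope ring_scope.

(* The inclusion of the subring B in A is an injective ring morphism iota;
   b acts on A on the right by multiplication by iota b. *)
Definition right_basis (A : nzRingType) (B : comNzRingType)
    (iota : {rmorphism B -> A}) (m : nat) (e : 'I_m -> A) : Prop :=
  forall a : A, exists! b : 'cV[B]_m, a = \sum_(i < m) e i * iota (b i 0).

Definition left_regular_repr_wrt (A : nzRingType) (B : comNzRingType)
    (iota : {rmorphism B -> A}) (m : nat) (f : 'I_m -> A)
    (L : A -> 'M[B]_m) : Prop :=
  forall (a : A) (j : 'I_m), a * f j = \sum_(i < m) f i * iota (L a i j).

(* The ordered basis f is arbitrary; the equations determine L from f, and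
   they make L an injective ring morphism. *)
Definition left_regular_repr (A : nzRingType) (B : comNzRingType)
    (iota : {rmorphism B -> A}) (m : nat) (L : A -> 'M[B]_m) : Prop :=
  exists f : 'I_m -> A,
    right_basis iota f /\ left_regular_repr_wrt iota f L.

(* A need not be commutative: horner evaluation puts the coefficients on the
   left of the powers of a, i.e. this is \sum_k iota p`_k * a ^+ k. *)
Definition eval_in (A : nzRingType) (B : comNzRingType)
    (iota : {rmorphism B -> A}) (p : {poly B}) (a : A) : A :=
  (map_poly iota p).[a].

(* Main.v *)
(** Conjugation by [e i] induces an endomorphism [s] of [B].  If [M] is the
    matrix of left multiplication by [a] in the basis [e], then [s M] is its
    matrix in the family [(e j * e i)_j], which spans [A] and is therefore
    again a basis.  So [M] and [s M] are similar, the coefficients of the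
    characteristic polynomial of [M] are fixed by [s], hence commute in [A]
    with every [e i], and the Cayley-Hamilton theorem for [M] can be
    transported to [a].  A change of basis does not affect the characteristic
    polynomial, which covers an arbitrary regular representation. *)
From HB Require Import structures.
Require Import Defs.
From mathcomp Require Import all_boot all_order all_algebra.

Set Implicit Arguments.
Unset Strict Implicit.

Import GRing.Theory.
Local Open Scope ring_scope.

(** Since [(X - M) P = P (X - N)], both characteristic polynomials agree after multiplication by
    [\det P], which [\det Q] cancels. *)
Lemma char_poly_intertwined (R : comNzRingType) (n : nat) (M N P Q : 'M[R]_n) :
  P *m Q = 1%:M -> M *m P = P *m N -> char_poly M = char_poly N.
Proof.
move=> PQ MP; rewrite /char_poly.
have PQX : map_mx polyC P *m map_mx polyC Q = 1%:M by rewrite -map_mxM PQ map_mx1.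
have detPQ : \det (map_mx polyC P) * \det (map_mx polyC Q) = 1.
  by rewrite -det_mulmx PQX det1.
have comm : char_poly_mx M *m map_mx polyC P = map_mx polyC P *m char_poly_mx N.
  by rewrite /char_poly_mx mulmxBl mulmxBr -!map_mxM MP scalar_mxC.
have /(congr1 (fun X => \det X)) := comm; rewrite !det_mulmx [RHS]mulrC => eqd.
by rewrite -[LHS]mulr1 -[RHS]mulr1 -detPQ !mulrA eqd.
Qed.

Section RightBasis.
Variables (A : nzRingType) (B : comNzRingType) (iota : {rmorphism B -> A}).
Variables (m : nat) (e : 'I_m -> A).
Hypothesis e_basis : right_basis iota e.
Let E : 'rV[A]_m := \row_i e i.

Lemma right_basis_mx_surj (n : nat) (X : 'rV[A]_n) :
  exists Q : 'M[B]_(m, n), X = E *m map_mx iota Q.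
Proof.
have /fin_all_exists [q Xq] (j : 'I_n) :
    exists b : 'cV[B]_m, X 0 j = \sum_i e i * iota (b i 0).
  by have [b [Xb _]] := e_basis (X 0 j); exists b.
exists (\matrix_(i, j) q j i 0); apply/rowP=> j; rewrite Xq mxE.
by apply: eq_bigr => i _; rewrite !mxE.
Qed.

Lemma right_basis_mx_inj (n : nat) (P Q : 'M[B]_(m, n)) :
  E *m map_mx iota P = E *m map_mx iota Q -> P = Q.
Proof.
move=> eqPQ; apply/matrixP=> i j.
have coord (R : 'M[B]_(m, n)) :
    (E *m map_mx iota R) 0 j = \sum_i e i * iota (col j R i 0).
  by rewrite mxE; apply: eq_bigr => k _; rewrite !mxE.
have [b [_ b_uniq]] := e_basis ((E *m map_mx iota P) 0 j).
have bP := b_uniq _ (coord P).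
have bQ : b = col j Q by apply: b_uniq; rewrite eqPQ coord.
have : col j P = col j Q by rewrite -bP.
by move/colP/(_ i); rewrite !mxE.
Qed.

(** Writing [F = E P], uniqueness of coordinates in [E] turns [E = E P Q] into [P Q = 1] and
    [E M P = a F = E P N] into [M P = P N]. *)
Lemma char_poly_spanning (F : 'rV[A]_m) (Q M N : 'M[B]_m) (a : A) :
    E = F *m map_mx iota Q ->
    a *: E = E *m map_mx iota M -> a *: F = F *m map_mx iota N ->
  char_poly M = char_poly N.
Proof.
move=> EQ aE aF; have [P FP] := right_basis_mx_surj F.
apply: (@char_poly_intertwined _ _ M N P Q); apply: right_basis_mx_inj.
  by rewrite map_mxM mulmxA -FP -EQ map_mx1 mulmx1.
by rewrite !map_mxM !mulmxA -aE -FP -aF FP scalemxAl.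
Qed.

End RightBasis.

Lemma left_regular_repr_wrt_mx (A : nzRingType) (B : comNzRingType)
    (iota : {rmorphism B -> A}) (m : nat) (f : 'I_m -> A) (L : A -> 'M[B]_m)
    (a : A) :
  left_regular_repr_wrt iota f L ->
  a *: (\row_i f i) = (\row_i f i) *m map_mx iota (L a).
Proof.
move=> Lf; apply/rowP=> j; rewrite !mxE Lf.
by apply: eq_bigr => i _; rewrite !mxE.
Qed.

(** Conjugation by [u] respects the ring laws in [A]; injectivity of [iota] pulls them back to the
    chosen preimages in [B]. *)
Lemma conjugation_rmorphism (B : comNzRingType) (A : unitRingType)
    (iota : {rmorphism B -> A}) (u : A) :
    injective iota -> u \is a GRing.unit ->
    (forall b, exists b', u^-1 * iota b * u = iota b') ->
  exists s : {rmorphism B -> B}, forall b, iota b * u = u * iota (s b).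
Proof.
move=> iota_inj Uu norm.
have norm' b : exists b', u^-1 * iota b * u == iota b'.
  by have [b' eb'] := norm b; exists b'; apply/eqP.
pose s b := xchoose (norm' b).
have sE b : iota (s b) = u^-1 * iota b * u.
  by rewrite -(eqP (xchooseP (norm' b))).
have s_zmod : zmod_morphism s.
  by move=> b c; apply: iota_inj; rewrite !(rmorphB, sE) mulrBr mulrBl.
have s_monoid : monoid_morphism s.
  split=> [|b c]; apply: iota_inj.
    by rewrite sE !rmorph1 mulr1 mulVr.
  by rewrite !(rmorphM, sE) !mulrA mulrK.
pose sZ := GRing.isZmodMorphism.Build _ _ s s_zmod.
pose sM := GRing.isMonoidMorphism.Build _ _ s s_monoid.
pose sR : {rmorphism B -> B} := HB.pack s sZ sM.
by exists sR => b; rewrite /= sE !mulrA divrr // mul1r.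
Qed.

Section NormalizingBasis.
Variables (B : comNzRingType) (A : unitRingType) (iota : {rmorphism B -> A}).
Variables (m : nat) (e : 'I_m -> A).
Hypothesis iota_inj : injective iota.
Hypothesis e_basis : right_basis iota e.
Hypothesis e_unit : forall i, e i \is a GRing.unit.
Hypothesis e_norm :
  forall i b, exists b', (e i)^-1 * iota b * e i = iota b'.
Let E : 'rV[A]_m := \row_i e i.
Variables (a : A) (M : 'M[B]_m).
Hypothesis aE : a *: E = E *m map_mx iota M.

Lemma char_poly_coef_comm (i : 'I_m) (k : nat) :
  iota (char_poly M)`_k * e i = e i * iota (char_poly M)`_k.
Proof.
have [s sP] := conjugation_rmorphism iota_inj (e_unit i) (e_norm i).
pose F : 'rV[A]_m := \row_j (e j * e i).
(* Right multiplication by [e i] turns [E] into [F]; moving it past the coefficients applies [s] to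
   them. *)
have EF (n : nat) (X : 'rV[A]_n) (R : 'M[B]_(m, n)) :
    X = E *m map_mx iota R -> \row_j (X 0 j * e i) = F *m map_mx iota (map_mx s R).
  move=> ->; apply/rowP=> j; rewrite !mxE mulr_suml.
  by apply: eq_bigr => l _; rewrite !mxE -!mulrA sP.
(* Expanding [e j / e i] in [E] and multiplying back by [e i] shows that [F] spans. *)
have [R XR] := right_basis_mx_surj e_basis (\row_j (e j * (e i)^-1)).
have FE : E = F *m map_mx iota (map_mx s R).
  by rewrite -(EF _ _ _ XR); apply/rowP=> j; rewrite !mxE mulrVK.
have aF : a *: F = F *m map_mx iota (map_mx s M).
  by rewrite -(EF _ _ _ aE); apply/rowP=> j; rewrite !mxE mulrA.
have eqM := char_poly_spanning e_basis FE aE aF.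
by rewrite sP -coef_map map_char_poly -eqM.
Qed.

Lemma eval_char_poly_basis : eval_in iota (char_poly M) a = 0.
Proof.
have comm := char_poly_coef_comm.
case: m e e_basis e_unit @E M aE comm => [|n] e0 e0_basis e0_unit E0 M0 aE0 comm.
  (* Rank 0 is impossible: 1 would be an empty sum. *)
  have [b [/eqP]] := e0_basis 1.
  by rewrite big_ord0 oner_eq0.
have aXE k : a ^+ k *: E0 = E0 *m map_mx iota (M0 ^+ k).
  elim: k => [|k IHk]; first by rewrite !expr0 scale1r map_mx1 mulmx1.
  by rewrite exprS -scalerA IHk scalemxAl aE0 exprS map_mxM mulmxA.
(* Commutation with the basis lets a coefficient acting on the left become a scalar matrix on the
   right. *)
have coefE k : iota (char_poly M0)`_k *: E0
    = E0 *m map_mx iota ((char_poly M0)`_k)%:M.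
  rewrite map_scalar_mx; apply/rowP=> j; rewrite !mxE comm (bigD1 j) //=.
  rewrite big1 ?addr0 => [|l /negPf nlj]; rewrite !mxE ?eqxx //.
  by rewrite nlj mulr0n mulr0.
have : eval_in iota (char_poly M0) a *: E0 = 0.
  rewrite /eval_in (horner_coef_wide _ (size_poly _ _)) scaler_suml.
  transitivity (E0 *m map_mx iota (horner_mx M0 (char_poly M0))); last first.
    by rewrite Cayley_Hamilton map_mx0 mulmx0.
  rewrite /horner_mx /horner_morph /=.
  rewrite (horner_coef_wide _ (size_poly _ _)) map_mx_sum mulmx_sumr.
  apply: eq_bigr => k _; rewrite !coef_map /= -scalerA aXE scalemxAl coefE.
  by rewrite map_mxM mulmxA.
(* One entry suffices, because [e0 0] is a unit. *)
move/rowP/(_ 0); rewrite !mxE => /(congr1 (fun x => x / e0 0)).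
by rewrite mul0r mulrK.
Qed.

End NormalizingBasis.

Unset Implicit Arguments.

Theorem theorem7p2 (B : comNzRingType) (A : unitRingType)
    (iota : {rmorphism B -> A}) (iota_inj : injective iota)
    (m : nat) (e : 'I_m -> A) (e_basis : right_basis iota e)
    (e_unit : forall i : 'I_m, e i \is a GRing.unit)
    (e_norm : forall (i : 'I_m) (b : B),
       exists b' : B, (e i)^-1 * iota b * e i = iota b')
    (L : A -> 'M[B]_m) (L_reg : left_regular_repr iota L) (a : A) :
  eval_in iota (char_poly (L a)) a = 0.
Proof.
have [f [f_basis Lf]] := L_reg.
have [M aE] := right_basis_mx_surj e_basis (a *: \row_i e i).
have [Q EQ] := right_basis_mx_surj f_basis (\row_i e i).
have aF := left_regular_repr_wrt_mx a Lf.
(* Passing from [f] to [e] replaces [L a] by [M], the matrix of left multiplication by [a] in the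
   normalizing basis. *)
rewrite -(char_poly_spanning e_basis EQ aE aF).
exact: (eval_char_poly_basis iota_inj e_basis e_unit e_norm aE).
Qed.
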